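(* Let $L$ be an infinitely distributive lattice. If $\operatorname{DM}(L)$ satisfies the Join-Infinite Distributive Law, then $A^{+-}=A^{\sigma_L}$ for every sublattice $A$ of $L$. In particular, $\operatorname{DM}(L)=\mathfrak I_L$.
   Context: A lattice $L$ satisfies the Join-Infinite Distributive Law (JID) if whenever $\bigvee A$ exists, $x\wedge\bigvee A=\bigvee_{a\in A}(x\wedge a)$ for every $x\in L$; it satisfies the Meet-Infinite Distributive Law (MID) if whenever $\bigwedge A$ exists, $x\vee\bigwedge A=\bigwedge_{a\in A}(x\vee a)$ for every $x\in L$. $L$ is infinitely distributive if it satisfies both. For $A\subseteq L$, $A^+$ and $A^-$ denote the sets of upper and lower bounds of $A$ in $L$, and $A^{+-}=(A^+)^-$. A lower cut is a set $C\subseteq L$ with $C=C^{+-}$. The Dedekind–MacNeille completion $\operatorname{DM}(L)$ is the complete lattice of all lower cuts of $L$, ordered by inclusion. A net $(x_\gamma)$ in $L$ order converges to $x\in L$ if there are a directed set $M\subseteq L$ and a filtered (downward directed) set $N\subseteq L$ with $\bigvee M=x=\bigwedge N$ such that for every $(m,n)\in M\times N$ the net is eventually in the interval $[m,n]$. A subset of $L$ is $O$-closed if it equals the set of all order limits of nets in it. An (order) ideal of $L$ is a downset closed under finite joins. For $A\subseteq L$, $A^{\sigma_L}$ is the smallest $O$-closed ideal of $L$ containing $A$, and $\mathfrak I_L$ is the collection of all $O$-closed ideals of $L$ ordered by inclusion. *)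

(* Defs.v *)
From HB Require Import structures.
From mathcomp Require Import all_boot all_order.
From mathcomp Require Import boolp classical_sets cardinality.

Set Implicit Arguments.
Unset Strict Implicit.
Unset Printing Implicit Defensive.

Import Order.TTheory.

Local Open Scope classical_set_scope.
Local Open Scope order_scope.

Section InfiniteDistributivity.
Context {d : Order.disp_t} (L : latticeType d).

(* [supremums A s] (resp. [infimums A s]) says that the join (resp. meet) of
   [A] exists and is [s]. *)
Definition JID : Prop :=
  forall (A : set L) (s : L), supremums A s ->
  forall x : L, supremums [set x `&` a | a in A] (x `&` s).

Definition MID : Prop :=
  forall (A : set L) (s : L), infimums A s ->
  forall x : L, infimums [set x `|` a | a in A] (x `|` s).

Definition infinitely_distributive : Prop := JID /\ MID.

End InfiniteDistributivity.

Section Cuts.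
Context {d : Order.disp_t} {L : latticeType d}.
Implicit Types A B C : set L.

Definition cut_closure A : set L := lbound (ubound A).

Lemma sub_cut_closure A : A `<=` cut_closure A.
Proof. by move=> x Ax y; apply. Qed.

Lemma cut_closureS A B : A `<=` B -> cut_closure A `<=` cut_closure B.
Proof. by move=> AB x Ax y By; apply: Ax => z /AB; exact: By. Qed.

Lemma cut_closureK A : cut_closure (cut_closure A) = cut_closure A.
Proof.
apply/seteqP; split; last exact: sub_cut_closure.
by move=> x Ax y Ay; apply: Ax => z; apply.
Qed.

End Cuts.

Definition lower_cuts {d} (L : latticeType d) : set (set L) :=
  [set C | C = cut_closure C].
Arguments lower_cuts {d} L.

(* The Dedekind-MacNeille completion, as a lattice ordered by inclusion. *)
Definition DM {d} (L : latticeType d) : Type := set_type (lower_cuts L).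

Section DedekindMacNeille.
Context {d : Order.disp_t} {L : latticeType d}.

HB.instance Definition _ := SubChoice.on (DM L).
HB.instance Definition _ :=
  [SubChoice_isSubPOrder of DM L by <: with set_display].

Lemma DM_leE (C D : DM L) : (C <= D) = (val C <= val D).
Proof. by []. Qed.

Lemma cut_closure_lower_cut (A : set L) : cut_closure A \in lower_cuts L.
Proof. by rewrite inE /lower_cuts /= cut_closureK. Qed.

Definition DM_of (A : set L) : DM L := SigSub (cut_closure_lower_cut A).

Lemma DM_valK (C : DM L) : cut_closure (val C) = val C.
Proof. by case: C => C /= /[!inE]. Qed.

Lemma DM_of_le (A : set L) (C : DM L) : (DM_of A <= C) = (A <= val C).
Proof.
rewrite DM_leE; apply/subsetPset/subsetPset => AC.
  by apply: subset_trans AC; exact: sub_cut_closure.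
by rewrite -(DM_valK C); exact: cut_closureS.
Qed.

Definition DM_meet (C D : DM L) : DM L := DM_of (val C `&` val D)%classic.
Definition DM_join (C D : DM L) : DM L := DM_of (val C `|` val D)%classic.

Lemma val_DM_meet (C D : DM L) : val (DM_meet C D) = (val C `&` val D)%classic.
Proof.
apply/seteqP; split; last exact: sub_cut_closure.
by move=> x CDx; split; rewrite -DM_valK; apply: cut_closureS CDx => y [].
Qed.

Lemma DM_meetP (B C D : DM L) : (B <= DM_meet C D) = (B <= C) && (B <= D).
Proof. by rewrite !DM_leE val_DM_meet -meetEset lexI. Qed.

Lemma DM_joinP (B C D : DM L) : (DM_join B C <= D) = (B <= D) && (C <= D).
Proof. by rewrite DM_of_le !DM_leE -joinEset leUx. Qed.

HB.instance Definition _ :=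
  Order.POrder_MeetJoin_isLattice.Build set_display (DM L) DM_meetP DM_joinP.

Lemma DM_supremums (F : set (DM L)) :
  supremums F (DM_of (\bigcup_(C in F) val C)).
Proof.
split=> [C FC|D FD].
  rewrite DM_leE; apply/subsetPset => x Cx.
  by apply: sub_cut_closure; exists C.
rewrite DM_of_le; apply/subsetPset => x [C FC Cx].
by have := FD _ FC; rewrite DM_leE => /subsetPset; apply.
Qed.

End DedekindMacNeille.

Definition directed_on {T : Type} (r : T -> T -> Prop) (M : set T) : Prop :=
  M !=set0 /\
  forall x y, M x -> M y -> exists z, [/\ M z, r x z & r y z].

(* [r] is a directed preorder on [D], so that functions on [D] are nets. *)
Definition directed_preorder {D : Type} (r : D -> D -> Prop) : Prop :=
  [/\ forall i, r i i,
      forall i j k, r i j -> r j k -> r i k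
    & directed_on r setT].

Section OrderConvergence.
Context {d : Order.disp_t} {L : latticeType d}.

Definition order_converges {D : Type} (r : D -> D -> Prop) (u : D -> L)
    (x : L) : Prop :=
  exists M N : set L,
    [/\ directed_on (fun a b : L => a <= b) M,
        directed_on (fun a b : L => b <= a) N,
        supremums M x,
        infimums N x
      & forall m n, M m -> N n ->
          exists i, forall j, r i j -> m <= u j <= n].

Definition order_limits (A : set L) : set L :=
  [set x | exists (D : Type) (r : D -> D -> Prop) (u : D -> L),
    [/\ directed_preorder r, forall i, A (u i) & order_converges r u x]].

Definition O_closed (A : set L) : Prop := A = order_limits A.

(* The finite joins include the empty one when it exists: an ideal contains
   the least element of [L] if there is one, and may be empty otherwise. This
   matches the lower cuts, the least of which is empty exactly when [L] has no
   least element. *)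
Definition order_ideal (I : set L) : Prop :=
  (forall x y, x <= y -> I y -> I x) /\
  (forall (F : set L) s, finite_set F -> F `<=` I -> supremums F s -> I s).

Definition sublattice (A : set L) : Prop :=
  forall x y, A x -> A y -> A (x `&` y) /\ A (x `|` y).

End OrderConvergence.

Definition O_closed_ideals {d} (L : latticeType d) : set (set L) :=
  [set I | O_closed I /\ order_ideal I].
Arguments O_closed_ideals {d} L.

Definition O_ideal_closure {d} {L : latticeType d} (A : set L) : set L :=
  smallest (O_closed_ideals L) A.

Section ClosureTheory.
Context {d : Order.disp_t} {L : latticeType d}.
Implicit Types A B : set L.

Lemma sub_order_limits A : A `<=` order_limits A.
Proof.
move=> x Ax; exists unit, (fun _ _ => True), (fun=> x); split=> //.
  by split=> //; split; [exists tt | move=> ? ?; exists tt].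
exists [set x], [set x]; split.
- by split=> [|_ _ -> ->]; exists x.
- by split=> [|_ _ -> ->]; exists x.
- by split=> [_ ->//|y]; apply.
- by split=> [_ ->//|y]; apply.
- by move=> _ _ -> ->; exists tt => _ _; rewrite lexx.
Qed.

Lemma order_limitsS A B : A `<=` B -> order_limits A `<=` order_limits B.
Proof.
by move=> AB x [D [r [u [rD uA ux]]]]; exists D, r, u; split=> // i; exact: AB.
Qed.

(* [smallest] is an intersection; here it is an O-closed ideal itself. *)
Lemma O_ideal_closure_ideal A : O_closed_ideals L (O_ideal_closure A).
Proof.
split; last split.
- apply/seteqP; split; first exact: sub_order_limits.
  move=> x xl I [II AI]; case: (II) => -> _.
  by apply: order_limitsS xl; exact: smallest_sub.
- move=> x y xy yS I [II AI]; case: (II) => _ [dI _].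
  by apply: dI xy _; exact: yS.
- move=> F s finF FS Fs I [II AI]; case: (II) => _ [_ jI].
  by apply: jI finF _ Fs => y /FS; exact.
Qed.

End ClosureTheory.

(* Main.v *)
Require Import Defs.
From mathcomp Require Import all_boot all_order.
From mathcomp Require Import boolp classical_sets.
From mathcomp Require Import cardinality.

(** The lower cuts and the O-closed ideals of [L] are the same sets; both claims
follow, since [cut_closure A] and [O_ideal_closure A] are the least members
above [A] of the one family and of the other.

A lower cut is an O-closed ideal because the lower bounds of a set are stable
under order limits: an element [m] of the directed set that witnesses the
convergence lies below some term of the net, hence below every upper bound of
the cut, and therefore so does the limit ([lower_cut_O_closed_ideal]).

Conversely, let [S] be an O-closed ideal and [x] an element of its cut closure.
In [DM L] the principal cut of [x] lies below the join of the principal cuts of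
the elements of [S]. The join-infinite distributive law of [DM L] turns this
into a statement about [L]: [x] is the join of its meets with the elements of
[S] ([supremums_meet_cut_closure]). These meets lie in the downset [S] and form
a directed set, so that as a net indexed by itself they order converge to [x],
and [x] is in [S] because [S] is O-closed ([O_closed_directed_supremums]). A
directed set has to be nonempty; when [S] is empty, [x] is the least element of
[L], which an ideal contains as its empty join. *)

Set Implicit Arguments.
Unset Strict Implicit.
Unset Printing Implicit Defensive.

Import Order.TTheory.

Local Open Scope classical_set_scope.
Local Open Scope order_scope.

Section OclosedIdealsAreCuts.
Context {d : Order.disp_t} {L : latticeType d}.
Implicit Types (A C M S : set L) (x y z : L).

Lemma cut_closure1 x y : cut_closure [set y] x <-> x <= y.
Proof.
split=> [|xy z]; first by apply=> _ ->.
by move=> /(_ y erefl); exact: le_trans.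
Qed.

Lemma lower_cut_O_closed C : lower_cuts L C -> O_closed C.
Proof.
move=> CE; apply/seteqP; split; first exact: sub_order_limits.
move=> x [D [r [u [[rr _ _] uC [M [N [_ [[n Nn] _] [_ Mx] _ MN]]]]]]].
rewrite CE => y Cy; apply: Mx => m Mm.
have [i /(_ i (rr i)) /andP[mui _]] := MN m n Mm Nn.
exact: le_trans mui (Cy _ (uC i)).
Qed.

Lemma lower_cut_order_ideal C : lower_cuts L C -> order_ideal C.
Proof.
move=> CE; split=> [x y xy Cy|F s _ FC [_ Fs]].
  by rewrite CE => z Cz; apply: le_trans xy (Cz _ Cy).
by rewrite CE => z Cz; apply: Fs => y /FC; exact: Cz.
Qed.

Lemma lower_cut_O_closed_ideal C : lower_cuts L C -> O_closed_ideals L C.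
Proof.
by move=> CE; split; [exact: lower_cut_O_closed|exact: lower_cut_order_ideal].
Qed.

Lemma order_ideal_join S x y : order_ideal S -> S x -> S y -> S (x `|` y).
Proof.
move=> [_ jS] Sx Sy; apply: (jS [set x; y]); first exact: finite_set2.
  by move=> z [] ->.
split=> [z [] ->|z zxy]; [exact: leUl|exact: leUr|].
by rewrite leUx !zxy //=; [right|left].
Qed.

(** A directed set, viewed as a net indexed by itself, increases to its join and
hence order converges to it, with the join alone as the filtered set. *)
Lemma O_closed_directed_supremums S M x :
  O_closed S -> directed_on (fun a b : L => a <= b) M -> M `<=` S ->
  supremums M x -> S x.
Proof.
move=> SE dM MS Mx; rewrite SE.
exists {a | M a}, (fun a b => sval a <= sval b), sval.
case: (dM) => -[a0 Ma0] dM2; split.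
- split=> [a|a b c|]; [exact: lexx|exact: le_trans|split].
    by exists (exist _ a0 Ma0).
  move=> [a Ma] [b Mb] _ _; have [c [Mc ac bc]] := dM2 a b Ma Mb.
  by exists (exist _ c Mc).
- by case=> a Ma; exact: MS.
- exists M, [set x]; split=> //.
  + by split=> [|_ _ -> ->]; exists x.
  + by split=> [_ ->//|y]; apply.
  + move=> m _ Mm ->; exists (exist _ m Mm) => -[b Mb] /= ->.
    exact: Mx.1.
Qed.

(** This is the infinite distributive law of [DM L], for the meet of the principal
cut of [x] with the join of the principal cuts of the elements of [S], read back
in [L]. The hypothesis on [x] says that this meet is the principal cut of [x],
and an upper bound [y] in [L] of the meets of [x] with the elements of [S] gives
in [DM L] a principal cut above all the distributed terms. *)
Lemma supremums_meet_cut_closure S x : JID (DM L) -> cut_closure S x ->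
  supremums [set x `&` s | s in S] x.
Proof.
move=> DMJ Sx; split=> [_ [s _ <-]|y xSy]; first exact: leIl.
pose F := [set DM_of [set s] | s in S].
have [_ xF] := DMJ F _ (DM_supremums F) (DM_of [set x]).
have : DM_of [set x] `&` DM_of (\bigcup_(C in F) val C) <= DM_of [set y].
  apply: xF => _ [_ [s Ss <-] <-].
  rewrite DM_leE; apply/subsetPset => z.
  rewrite val_DM_meet => -[/cut_closure1 zx /cut_closure1 zs].
  apply/cut_closure1; apply: le_trans (xSy _ _); last by exists s.
  by rewrite lexI zx zs.
rewrite DM_leE => /subsetPset/(_ x) xy; apply/cut_closure1/xy.
rewrite val_DM_meet; split; first exact/cut_closure1.
apply: cut_closureS Sx => s Ss; exists (DM_of [set s]); first by exists s.
exact/cut_closure1.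
Qed.

Lemma O_closed_ideal_lower_cut S :
  JID (DM L) -> O_closed_ideals L S -> lower_cuts L S.
Proof.
move=> DMJ [OS iS]; apply/seteqP; split; first exact: sub_cut_closure.
move=> x Sx; have [S0|/set0P[s0 Ss0]] := eqVneq S set0.
  (* Every element of [L] is an upper bound of the empty set, so that [x] is the
     least one. *)
  apply: (iS.2 set0) => //; split=> // y _.
  by apply: Sx => z; rewrite S0.
apply: (O_closed_directed_supremums OS) (supremums_meet_cut_closure DMJ Sx).
  split; first by exists (x `&` s0), s0.
  move=> _ _ [s Ss <-] [t St <-]; exists (x `&` (s `|` t)); split.
  - by exists (s `|` t) => //; exact: order_ideal_join.
  - by rewrite leI2 // leUl.
  - by rewrite leI2 // leUr.
by move=> _ [s Ss <-]; apply: iS.1 Ss; exact: leIr.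
Qed.

End OclosedIdealsAreCuts.

Theorem proposition3p13 (d : Order.disp_t) (L : latticeType d)
    (L_infdistr : infinitely_distributive L) (DM_JID : JID (DM L)) :
  (forall A : set L, sublattice A -> cut_closure A = O_ideal_closure A) /\
  lower_cuts L = O_closed_ideals L.
Proof.
split=> [A _|]; last first.
  apply/seteqP; split=> S; first exact: lower_cut_O_closed_ideal.
  exact: O_closed_ideal_lower_cut.
apply/seteqP; split.
  rewrite (O_closed_ideal_lower_cut DM_JID (O_ideal_closure_ideal A)).
  by apply: cut_closureS; exact: sub_smallest.
apply: smallest_sub; last exact: sub_cut_closure.
by apply: lower_cut_O_closed_ideal; rewrite /lower_cuts /= cut_closureK.
Qed.
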